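(* Let $S=\{b_1,\ldots,b_k\}\subseteq\mathcal{P}$ be a finite set of perfect integer powers (with $b_1,\ldots,b_k$ distinct). Define polynomials in $\mathbb{Z}[x]$ by \[ g(x)=\bigl((x-b_1)\cdots(x-b_k)\bigr)^4+1,\qquad f_S(x)=g(x)\bigl((x-1)g(x)+1\bigr). \] Then: (i) for every $x\in\mathbb{Z}$, $f_S(x)\in\mathcal{P}$ if and only if $x\in S$; (ii) $f_S(\mathbb{Z})\cap\mathcal{P}=S$.
   Context: $\mathcal{P}=\{a^m : a\in\mathbb{Z},\ m\in\mathbb{Z},\ m\geq 2\}\subseteq\mathbb{Z}$ denotes the set of all perfect integer powers. For a polynomial $f\in\mathbb{Z}[x]$, $f(\mathbb{Z})=\{f(n): n\in\mathbb{Z}\}$. An empty product equals $1$. *)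

(* Defs.v *)
From HB Require Import structures.
From mathcomp Require Import all_boot all_order all_algebra finmap.
From mathcomp Require Import boolp classical_sets.

Set Implicit Arguments.
Unset Strict Implicit.
Unset Printing Implicit Defensive.

Import GRing.Theory Num.Theory.
Local Open Scope classical_set_scope.
Local Open Scope ring_scope.

Definition perfect_powers : set int :=
  [set y | exists (a : int) (m : nat), (2 <= m)%N /\ y = a ^+ m].

Definition gpoly (S : {fset int}) : {poly int} :=
  (\prod_(b <- S) ('X - b%:P)) ^+ 4 + 1.

Definition fpoly (S : {fset int}) : {poly int} :=
  gpoly S * (('X - 1) * gpoly S + 1).

(* Main.v *)
(** At a point [x] outside [S], [f_S(x)] is a product of two coprime factors,
    so if it is a perfect power then so is the first factor [P ^ 4 + 1] with
    [P != 0]; Lebesgue's theorem ([x ^ 2 + 1 = y ^ m] with [m >= 2] forces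
    [x = 0]) excludes this.  For Lebesgue's theorem, [m] may be taken odd.
    Then [x + i] is an [m]-th power [(a + b i) ^ m] of a Gaussian integer;
    comparing imaginary parts gives [b = 1] or [b = -1], hence the real part of
    [(1 + c i) ^ m], where [c] is [a] or [- a], is [1] or [-1].  Here [c] is
    even, and the 2-adic valuation of [Re (1 + c i) ^ m - 1] is that of
    [c ^ 2 (m - 1) / 2], which forces [c = 0]. *)
Require Import Defs.
From HB Require Import structures.
From mathcomp Require Import all_boot all_order all_algebra finmap.
From mathcomp Require Import boolp classical_sets.
From mathcomp Require Import ring zify.

Set Implicit Arguments.
Unset Strict Implicit.

Import GRing.Theory Num.Theory.
Local Open Scope classical_set_scope.
Local Open Scope ring_scope.

(** * Gaussian integers, up to the extraction of an [m]-th root of [x + i] *)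

Definition gint := (int * int)%type.

(** Only the additive structure is taken from pairs, since the product ring on them is
    componentwise. *)
HB.instance Definition _ := GRing.Zmodule.on gint.

Definition gmul (z w : gint) : gint :=
  (z.1 * w.1 - z.2 * w.2, z.1 * w.2 + z.2 * w.1).

Lemma gmulA : associative gmul.
Proof. by move=> [a b] [c d] [e f]; congr pair => /=; ring. Qed.

Lemma gmulC : commutative gmul.
Proof. by move=> [a b] [c d]; congr pair => /=; ring. Qed.

Lemma gmul1 : left_id ((1, 0) : gint) gmul.
Proof. by move=> [a b]; congr pair => /=; ring. Qed.

Lemma gmulDl : left_distributive gmul +%R.
Proof. by move=> [a b] [c d] [e f]; congr pair => /=; ring. Qed.

Lemma gone_neq0 : ((1, 0) : gint) != 0.
Proof. by []. Qed.

HB.instance Definition _ :=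
  GRing.Zmodule_isComNzRing.Build gint gmulA gmulC gmul1 gmulDl gone_neq0.

Definition gI : gint := (0, 1).

Definition gconj (z : gint) : gint := (z.1, - z.2).

Definition gnorm (z : gint) : int := z.1 ^+ 2 + z.2 ^+ 2.

Lemma gmulE (z w : gint) :
  z * w = (z.1 * w.1 - z.2 * w.2, z.1 * w.2 + z.2 * w.1).
Proof. by []. Qed.

Lemma gintzE (n : int) : n%:~R = (n, 0) :> gint.
Proof.
have natE (k : nat) : k%:R = (k%:Z, 0) :> gint.
  by elim: k => [//|k IH]; rewrite mulrS IH; congr pair => /=; lia.
case: n => k; first exact: natE.
by rewrite NegzE mulrNz -pmulrn natE; congr pair.
Qed.

Lemma gnormM (z w : gint) : gnorm (z * w) = gnorm z * gnorm w.
Proof. by case: z w => [a b] [c d]; rewrite /gnorm gmulE /=; ring. Qed.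

Lemma gnormX (z : gint) (m : nat) : gnorm (z ^+ m) = gnorm z ^+ m.
Proof. by elim: m => [//|m IH]; rewrite !exprS gnormM IH. Qed.

Lemma gmul_conj (z : gint) : z * gconj z = (gnorm z)%:~R.
Proof.
by case: z => a b; rewrite gintzE gmulE /gnorm; congr pair => /=; ring.
Qed.

Lemma gconjM (z w : gint) : gconj (z * w) = gconj z * gconj w.
Proof. by case: z w => [a b] [c d]; congr pair => /=; ring. Qed.

Lemma gnorm_eq1 (w : gint) :
  gnorm w = 1 -> [\/ w = (1, 0), w = (-1, 0), w = (0, 1) | w = (0, -1)].
Proof.
case: w => a b; rewrite /gnorm /= => N1.
have [a0|[a1|a1]] : a = 0 \/ a = 1 \/ a = -1 by nia.
- have [b1|b1] : b = 1 \/ b = -1 by nia.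
  + by rewrite a0 b1; constructor 3.
  + by rewrite a0 b1; constructor 4.
- by have b0 : b = 0 by [nia]; rewrite a1 b0; constructor 1.
- by have b0 : b = 0 by [nia]; rewrite a1 b0; constructor 2.
Qed.

Lemma gnorm1_expr4 (w : gint) : gnorm w = 1 -> w ^+ 4 = 1.
Proof. by case/gnorm_eq1 => ->. Qed.

(* [x + i = r + i + q n] with [2 |r| <= n]; if [r ^ 2 + 1 = n n'] then
   [n' < n], and the cofactor in [r + i] of a divisor of norm [n'] has norm [n]
   and divides [n], hence also [x + i]. *)
Lemma gauss_divisor_of_norm (n x y : int) :
  0 < n -> x ^+ 2 + 1 = n * y ->
  exists z w : gint, z * w = (x, 1) /\ gnorm z = n.
Proof.
move: {2}(`|n|%N) (leqnn `|n|%N) => k.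
elim: k n x y => [|k IH] n x y le_nk n_gt0 xy; first by lia.
have [n1|n_gt1] : n = 1 \/ 1 < n by lia.
  by exists 1, (x, 1); rewrite mul1r n1.
have [q [r [xE r_lb r_ub]]] :
    exists q r : int, [/\ x = q * n + r, - n <= 2 * r & 2 * r <= n].
  have xE := divz_eq x n.
  have r_ge0 : 0 <= (x %% n)%Z by apply: modz_ge0; lia.
  have r_lt : (x %% n)%Z < n by apply: ltz_pmod.
  have [le|gt] : 2 * (x %% n)%Z <= n \/ n < 2 * (x %% n)%Z by lia.
    by exists (x %/ n)%Z, (x %% n)%Z; split; lia.
  by exists ((x %/ n)%Z + 1), ((x %% n)%Z - n); split; lia.
pose n' := y - q * (q * n + 2 * r).
have rE : r ^+ 2 + 1 = n' * n by rewrite /n'; move: xy; rewrite xE; lia.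
have n'_gt0 : 0 < n' by nia.
have n'_lt : n' < n by nia.
have [|z [w [zw Nz]]] := IH n' r n _ n'_gt0 rE; first lia.
have Nw : gnorm w = n.
  have : n' * gnorm w = n' * n.
    by rewrite -rE -Nz -gnormM zw /gnorm /=; ring.
  by apply: mulfI; lia.
exists w, (z + gconj w * q%:~R); split=> //.
rewrite mulrDr mulrA gmul_conj [w * z]mulrC zw Nw !gintzE xE.
by congr pair => /=; ring.
Qed.

(* [z] and [conj w] divide the conjugates [x + i] and [x - i], whose difference
   is [2 i], so they are coprime as soon as [z] has odd norm; since [z] divides
   [gnorm w = w * conj w], it divides [w]. *)
Lemma gauss_dvd_cofactor (x y : int) (k m : nat) (z w : gint) :
  (exists c, y = 2 * c + 1) -> gnorm z = y ->
  z ^+ k.+1 * w = (x, 1) -> gnorm w = y ^+ m.+1 ->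
  exists2 w', w = z * w' & gnorm w' = y ^+ m.
Proof.
move=> [c yE] Nz zw Nw.
pose s := z ^+ k * w; pose t := gconj (z ^+ k.+1).
have wt : gconj w * t = (x, -1) by rewrite mulrC -gconjM zw.
have zs : z * s = (x, 1) by rewrite mulrA -exprS.
have diff : z * s - gconj w * t = 2 * gI.
  by rewrite zs wt; congr pair => /=; lia.
have I2 : gI * gI = -1 by [].
(* Here [z * gconj z = 2 * c + 1], and [c i] times the difference [2 i] is [- 2 c]. *)
have bezout : z * (gconj z + c%:~R * gI * s) - gconj w * t * c%:~R * gI = 1.
  have -> : z * (gconj z + c%:~R * gI * s) - gconj w * t * c%:~R * gI =
     z * gconj z + c%:~R * gI * (z * s - gconj w * t) by ring.
  rewrite diff gmul_conj Nz yE rmorphD rmorphM /=.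
  have -> : c%:~R * gI * (2 * gI) = 2 * c%:~R * (gI * gI) :> gint by ring.
  by rewrite I2; ring.
(* This is [bezout] times [w], divided by [z]: [w * gconj w = y ^ m.+1] contains the factor
   [y = z * gconj z]. *)
pose w' := (gconj z + c%:~R * gI * s) * w
           - gconj z * (y ^+ m)%:~R * t * c%:~R * gI.
have ww' : w = z * w'.
  rewrite -[LHS]mulr1 -[X in w * X]bezout.
  have -> : w * (z * (gconj z + c%:~R * gI * s) - gconj w * t * c%:~R * gI) =
      z * (gconj z + c%:~R * gI * s) * w - (w * gconj w) * t * c%:~R * gI.
    by ring.
  rewrite gmul_conj Nw exprS rmorphM /= -{1}Nz -gmul_conj /w'; ring.
exists w' => //.
have : y * gnorm w' = y * y ^+ m by rewrite -exprS -Nw ww' gnormM Nz.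
by apply: mulfI; lia.
Qed.

(** A divisor [z] of norm [y] is split off [x + i] repeatedly until the cofactor is a unit, which is
    then absorbed into the root. *)
Lemma gauss_power_of_root (x y : int) (m : nat) :
  (exists c, y = 2 * c + 1) -> 0 < y -> odd m -> x ^+ 2 + 1 = y ^+ m ->
  exists2 z : gint, z ^+ m = (x, 1) & gnorm z = y.
Proof.
case: m => // m y_odd y_gt0 m_odd xy.
have [|z [w [zw Nz]]] := @gauss_divisor_of_norm y x (y ^+ m) y_gt0.
  by rewrite -exprS.
have step k : (k <= m)%N ->
    exists2 w, z ^+ k.+1 * w = (x, 1) & gnorm w = y ^+ (m - k).
  elim: k => [_|k IH lt_km].
    exists w; first by rewrite expr1.
    have : y * gnorm w = y * y ^+ m.
      by rewrite -exprS -xy -{1}Nz -gnormM zw /gnorm /=; ring.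
    by rewrite subn0; apply: mulfI; lia.
  have [v zv Nv] := IH (ltnW lt_km).
  have Nv' : gnorm v = y ^+ (m - k.+1).+1 by rewrite Nv; congr (_ ^+ _); lia.
  have [v' vv' Nv'1] := gauss_dvd_cofactor y_odd Nz zv Nv'.
  by exists v'; rewrite // exprSr -mulrA -vv'.
have [u zu Nu] := step m (leqnn m); rewrite subnn expr0 in Nu.
(* An odd square is [1] modulo [4] and [u ^ 4 = 1], so the unit [u] is the [m.+1]-th power of
   [u ^ m.+1]. *)
exists (u ^+ m.+1 * z); last by rewrite gnormM gnormX Nu expr1n mul1r.
have [j mE] : exists j, (m.+1 * m.+1 = 4 * j + 1)%N.
  exists (m.+1./2 * m.+1./2 + m.+1./2)%N.
  by rewrite -{1 2}(odd_double_half m.+1) m_odd -mul2n; nia.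
rewrite exprMn -exprM mE exprD exprM gnorm1_expr4 // expr1n mul1r expr1.
by rewrite mulrC.
Qed.

(** * Real and imaginary parts of Gaussian powers *)

Lemma gexp_im_dvd (z : gint) (m : nat) : exists c, (z ^+ m).2 = z.2 * c.
Proof.
elim: m => [|m [c IH]]; first by exists 0; rewrite mulr0.
by exists (z.1 * c + (z ^+ m).1); rewrite exprS gmulE /= IH; ring.
Qed.

(** Induction multiplies by [(1 + 2 c i) ^ 2 = 1 - 4 c ^ 2 + 4 c i]. The parity of [al] is recorded
    because an odd [t] then makes the valuation exact. *)
Lemma gexp_even (c : int) (t : nat) : exists al be d : int,
  ((1, 2 * c) : gint) ^+ (2 * t) = (1 + 4 * c ^+ 2 * al, 4 * c * be) /\
  al = t%:Z + 2 * d.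
Proof.
elim: t => [|t [al [be [d [IH alE]]]]].
  by exists 0, 0, 0; split=> //; rewrite muln0 expr0 !mulr0 addr0.
exists (al - 1 - 4 * c ^+ 2 * al - 4 * be), (be + 1 + 4 * c ^+ 2 * al
  - 4 * c ^+ 2 * be), (d - 1 - 2 * c ^+ 2 * al - 2 * be).
split; last by rewrite alE; lia.
rewrite mulnS exprD IH expr2 !gmulE /=; congr pair; ring.
Qed.

(** Each squaring doubles the deviation of the real part from [1]; the quadratic corrections change
    the cofactor [2 * al + 1] by even amounts only, so it stays odd. *)
Lemma gexp_two_power (c : int) (t s : nat) : odd t -> exists al be : int,
  ((1, 2 * c) : gint) ^+ (2 * t * 2 ^ s) =
  (1 + 2 ^+ s * 4 * c ^+ 2 * (2 * al + 1), 2 ^+ s * 4 * c * be).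
Proof.
move=> t_odd; elim: s => [|s [al [be IH]]].
  have [al [be [d [E alE]]]] := gexp_even c t.
  exists (t./2%:Z + d), be; rewrite muln1 E expr0 !mul1r.
  by congr (1 + _ * _, _); lia.
exists (al + 2 ^+ s * c ^+ 2 * (2 * al + 1) ^+ 2 - 2 ^+ s * be ^+ 2),
  (be * (1 + 2 ^+ s * 4 * c ^+ 2 * (2 * al + 1))).
rewrite expnSr mulnA exprM IH expr2 gmulE !exprS /=; congr pair; ring.
Qed.

Lemma gexp_re_unit (c : int) (m : nat) :
  odd m -> (1 < m)%N -> (((1, 2 * c) : gint) ^+ m).1 ^+ 2 = 1 -> c = 0.
Proof.
move=> m_odd m_gt1 /eqP.
have [|t t_odd mE] := @pfactor_coprime 2 m./2 isT; first by lia.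
set s := logn 2 _ in mE; rewrite coprime2n in t_odd.
have [al [be E]] := gexp_two_power c s t_odd.
have {mE}-> : m = (2 * t * 2 ^ s).+1.
  by rewrite -mulnA -mE; lia.
(* The real part is [1 + 4 * 2 ^ s * c ^ 2 * (2 * (al - be) + 1)]: the value [1] forces [c = 0], and
   [-1] is impossible modulo [4]. *)
rewrite sqrf_eq1 exprS E gmulE /= => /orP[] /eqP H.
  have : 2 ^+ s * (c ^+ 2 * (2 * (al - be) + 1)) = 0 by lia.
  move/eqP; rewrite !mulf_eq0 !expf_eq0 /= andbF => /orP[/eqP //|/eqP].
  by lia.
have : 4 * (2 ^+ s * (c ^+ 2 * (2 * (al - be) + 1))) = - 2 by lia.
lia.
Qed.

(** * Lebesgue's theorem *)

Lemma exp_odd_int (c : int) (m : nat) :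
  exists d, (2 * c + 1) ^+ m = 2 * d + 1.
Proof.
elim: m => [|m [d IH]]; first by exists 0.
by exists (2 * c * d + c + d); rewrite exprS IH; ring.
Qed.

Lemma lebesgue_odd (x y : int) (m : nat) :
  odd m -> (1 < m)%N -> x ^+ 2 + 1 = y ^+ m -> x = 0.
Proof.
move=> m_odd m_gt1 xy.
have xpar : exists q, x = 2 * q \/ x = 2 * q + 1.
  by exists (x %/ 2)%Z; lia.
have [c yE] : exists c, y = 2 * c + 1.
  have [c [yE|yE]] : exists c, y = 2 * c \/ y = 2 * c + 1.
    by exists (y %/ 2)%Z; lia.
  (* An even [y] would make [x ^ 2 + 1] divisible by [4]. *)
  - move: xy; rewrite -(subnKC m_gt1) exprD yE; case: xpar => q [|] ->;
      by set Y := _ ^+ (m - 2); lia.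
  - by exists c.
have y_gt0 : 0 < y.
  have [//|y_le0] : 0 < y \/ y <= 0 by lia.
  have : y ^+ m <= 0 by rewrite exprn_odd_le0.
  by rewrite -xy; nia.
have [z zm Nz] :=
  gauss_power_of_root (ex_intro _ c yE) y_gt0 m_odd xy.
case: z zm Nz => a b zm; rewrite /gnorm /= => Nz.
have [e eE] := gexp_im_dvd (a, b) m; rewrite zm /= in eE.
have b2 : b ^+ 2 = 1.
  have : (`|b| * `|e|)%N == 1%N by rewrite -abszM -eE.
  rewrite muln_eq1 => /andP[/eqP b1 _].
  by have [->|->] : b = 1 \/ b = - 1 by lia.
have [a' aE] : exists a', a = 2 * a'.
  have [a' [|aE]] : exists a', a = 2 * a' \/ a = 2 * a' + 1.
    by exists (a %/ 2)%Z; lia.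
  - by exists a'.
  - by move: Nz; rewrite b2 yE aE; lia.
(* The unit [- b i] turns [a + b i] into [1 - a b i]. As [m] is odd, its [m]-th power [u i] is [i]
   or [- i], and [u i (x + i)] has real part [- u]. *)
have negz : (1, 2 * (- (b * a'))) = ((0, - b) : gint) * (a, b).
  by rewrite gmulE aE /=; congr pair; lia.
have unitm : exists2 u : int, ((0, - b) : gint) ^+ m = (0, u) & u ^+ 2 = 1.
  rewrite -(odd_double_half m) m_odd -mul2n.
  elim: m./2 => [|k [u IH u2]]; first by exists (- b); rewrite ?expr1 ?sqrrN.
  exists (- u); last by rewrite sqrrN.
  rewrite mulnS addnCA exprD IH expr2 !gmulE /=; congr pair; first by ring.
  by rewrite mul0r !mulr0 !add0r -[RHS]mulr1 -b2; ring.
have [u uE u2] := unitm.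
have a'0 : - (b * a') = 0.
  apply: (gexp_re_unit m_odd m_gt1); rewrite negz exprMn uE zm gmulE /=.
  by rewrite mul0r sub0r mulr1 sqrrN.
have a0 : a = 0 by nia.
have : y ^+ m = 1 by rewrite -Nz a0 b2 expr0n /= add0r expr1n.
by rewrite -xy; nia.
Qed.

Lemma lebesgue (x y : int) (m : nat) :
  (1 < m)%N -> x ^+ 2 + 1 = y ^+ m -> x = 0.
Proof.
move=> m_gt1 xy; have [m_odd|m_even] := boolP (odd m).
  exact: lebesgue_odd xy.
(* For even [m], [x ^ 2] and [x ^ 2 + 1] are both squares, which leaves only [0] and [1]. *)
move: xy; rewrite -(odd_double_half m) (negbTE m_even) add0n -muln2 exprM.
move: (y ^+ _) => u; rewrite -(real_normK (num_real u)) -(real_normK (num_real x)) => xu.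
apply/normr0_eq0; move: (normr_ge0 x) (normr_ge0 u) xu.
move: `|x| `|u| => X U X_ge0 U_ge0 XU.
have [U_lt|U_gt] : U < X + 1 \/ X + 1 <= U by lia.
  nia.
by have : (X + 1) * (X + 1) <= U * U by [apply: ler_pM; lia]; lia.
Qed.

(** * From perfect powers to the values of [f_S] *)

(** With [c = gcdn u a], [u = u' c] and [a = a' c], cancelling [c] gives [u' v = a' ^ m.+1 c ^ m];
    coprimality of [u'] with [a'] and of [c] with [v] yields [u' = c ^ m]. *)
Lemma coprime_mul_eq_exp (u v a m : nat) :
  coprime u v -> (u * v = a ^ m.+1)%N -> exists c, (u = c ^ m.+1)%N.
Proof.
move=> cop uv; exists (gcdn u a).
have [u0|u_gt0] := posnP u.
  move: uv; rewrite u0 gcd0n mul0n => /esym/eqP.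
  by rewrite expn_eq0 andbT => /eqP ->; rewrite exp0n.
have c_gt0 : (0 < gcdn u a)%N by rewrite gcdn_gt0 u_gt0.
have /dvdnP[u' uE] := dvdn_gcdl u a; have /dvdnP[a' aE] := dvdn_gcdr u a.
have cop_cv : coprime (gcdn u a) v by apply: coprime_dvdl cop; apply: dvdn_gcdl.
have cop' : coprime u' a'.
  by rewrite /coprime -(eqn_pmul2r c_gt0) muln_gcdl -uE -aE mul1n.
move: (gcdn u a) => c in uE aE c_gt0 cop_cv *.
have {}uv : (u' * v = a' ^ m.+1 * c ^ m)%N.
  apply/eqP; rewrite -(eqn_pmul2r c_gt0) mulnAC -uE uv aE expnMn.
  by rewrite -mulnA -expnSr.
rewrite uE expnSr; congr (_ * _)%N; apply/eqP; rewrite eqn_dvd; apply/andP; split.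
  rewrite -(@Gauss_dvdr u' (a' ^ m.+1)) ?coprimeXr // -uv; exact: dvdn_mulr.
rewrite -(@Gauss_dvdl _ _ v) ?coprimeXl // uv; exact: dvdn_mull.
Qed.

Unset Implicit Arguments.
Set Strict Implicit.

Theorem theorem4p1 (S : {fset int}) (hS : [set` S] `<=` perfect_powers) :
  (forall x : int, perfect_powers (fpoly S).[x] <-> x \in S) /\
  range (fun n : int => (fpoly S).[n]) `&` perfect_powers = [set` S].
Proof.
pose P x := \prod_(b <- S) (x - b).
have PE x : (\prod_(b <- S) ('X - b%:P)).[x] = P x.
  by rewrite horner_prod; apply: eq_bigr => b _; rewrite !hornerE.
pose g x := P x ^+ 4 + 1.
have gE x : (gpoly S).[x] = g x by rewrite /gpoly !hornerE PE.
have fE x : (fpoly S).[x] = g x * ((x - 1) * g x + 1).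
  rewrite -gE /fpoly; move: (gpoly S) => q.
  by rewrite hornerM hornerD hornerM hornerD hornerN hornerX !hornerC.
have P0 x : (P x == 0) = (x \in S).
  rewrite /P prodf_seq_eq0; apply/hasP/idP => [[b bS]|xS].
    by rewrite subr_eq0 => /eqP ->.
  by exists x; rewrite ?subrr.
(* At a root of [P] the value of [g] is [1], so [f_S] fixes every element of [S]. *)
have fS x : x \in S -> (fpoly S).[x] = x.
  by rewrite -P0 fE /g => /eqP ->; rewrite expr0n /=; ring.
have iffS x : perfect_powers (fpoly S).[x] <-> x \in S.
  split=> [[a [m [m_gt1]]]|xS]; last by rewrite fS //; apply: hS.
  rewrite fE => fam.
  (* The second factor is [1] modulo [g x]. *)
  have cop : coprimez (g x) ((x - 1) * g x + 1).
    by rewrite /coprimez gcdzMDl gcdz1.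
  rewrite coprimezE in cop.
  have absE : (`|g x| * `|((x - 1) * g x + 1)%R|)%N = (`|a| ^ m.-1.+1)%N.
    by rewrite prednK ?(ltnW m_gt1) // -abszM fam abszX.
  have [c gc] := coprime_mul_eq_exp cop absE.
  rewrite prednK ?(ltnW m_gt1) // in gc.
  (* Lebesgue's theorem is applied to the square of [P x ^ 2]; positivity of [g x] removes the
     absolute value. *)
  have /(lebesgue m_gt1)/eqP : (P x ^+ 2) ^+ 2 + 1 = c%:Z ^+ m.
    rewrite -exprM -/(g x) -rmorphXn /= natrXE -gc gez0_abs // /g.
    by rewrite addr_ge0 // exprn_even_ge0.
  by rewrite expf_eq0 /= P0.
split=> //; apply/seteqP; split=> y /=.
  by move=> [[n _ <-] /iffS nS]; rewrite fS.
by move=> yS; split; [exists y; rewrite ?fS|apply: hS].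
Qed.
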